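(* Let $w\in\mathbf{F}_r$, and let $G(N)=C_m\wr S_N$ for some fixed integer $m\ge 2$, or $G(N)=\mathcal{S}^1\wr S_N$. Then there is a rational function $f\in\mathbb{Q}(x)$ such that for every large enough $N$, $\mathcal{T}r_w(G(N))=f(N)$.
   Context: $\mathbf{F}_r$ is the free group with basis $x_1,\dots,x_r$. $\mathcal{S}^1\wr S_N$ denotes the subgroup of $\mathrm{GL}_N(\mathbb{C})$ consisting of matrices with exactly one non-zero entry in every row and every column, all non-zero entries having absolute value $1$. For an integer $m\ge2$, $C_m\wr S_N$ denotes the (finite) subgroup of $\mathcal{S}^1\wr S_N$ of matrices all of whose non-zero entries are $m$-th roots of unity. For a compact matrix group $G$, $\mathcal{T}r_w(G)$ denotes the expected value of the trace of $w(A_1,\dots,A_r)$, where $A_1,\dots,A_r$ are independent Haar-distributed random elements of $G$ and $w(A_1,\dots,A_r)$ is obtained by substituting $A_i$ for $x_i$ in $w$. *)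

(* Defs.v *)
From HB Require Import structures.
From mathcomp Require Import all_boot all_order all_algebra.
From mathcomp Require Import fraction complex.
From mathcomp Require Import all_classical all_reals all_analysis.

Set Implicit Arguments.
Unset Strict Implicit.
Unset Printing Implicit Defensive.

Import Order.TTheory GRing.Theory Num.Theory.
Import numFieldNormedType.Exports.
Local Open Scope classical_set_scope.
Local Open Scope ring_scope.

(* The letter (i, false) is the generator x_i and (i, true) its inverse.      *)
Definition letter (r : nat) : Type := ('I_r * bool)%type.

Definition not_inverse (r : nat) (a b : letter r) : bool :=
  ~~ ((a.1 == b.1) && (a.2 != b.2)).

(* Each element of the free group on x_0, ..., x_(r-1) has a unique           *)
(* expression as a reduced word, one in which no letter is followed by its    *)
(* inverse.                                                                   *)
Definition free_group (r : nat) : Type :=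
  {w : seq (letter r) | sorted (@not_inverse r) w}.

Definition letter_eval (K : comUnitRingType) (N r : nat)
    (A : 'I_r -> 'M[K]_N) (a : letter r) : 'M[K]_N :=
  if a.2 then invmx (A a.1) else A a.1.

Definition word_eval (K : comUnitRingType) (N r : nat) (w : free_group r)
    (A : 'I_r -> 'M[K]_N) : 'M[K]_N :=
  \big[mulmx/1%:M]_(a <- sval w) letter_eval A a.

Definition monomial_mx (K : pzRingType) (N : nat) (A : 'M[K]_N) : Prop :=
  (forall i, exists! j, A i j != 0) /\ (forall j, exists! i, A i j != 0).

Definition circle_wr_sym (R : realType) (N : nat) : set 'M[R[i]]_N :=
  [set A | monomial_mx A /\ forall i j, A i j != 0 -> `|A i j| = 1].

Definition cyclic_wr_sym (R : realType) (m N : nat) : set 'M[R[i]]_N :=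
  [set A | circle_wr_sym A /\
           forall i j, A i j != 0 -> m.-unity_root (A i j)].

(* The copy R[i]^o of R[i] carries the topology given by the modulus.         *)
Definition borel_mx (R : realType) (N : nat) : measurableType _ :=
  g_sigma_algebraType [set U : set 'M[R[i]^o]_N | open U].

(* The Haar probability measure of a closed matrix group G, viewed as a Borel *)
(* measure on the space of all matrices that is concentrated on G.            *)
Definition is_haar (R : realType) (N : nat) (G : set 'M[R[i]]_N)
    (mu : probability (borel_mx R N) R) : Prop :=
  mu G = 1%E /\
  forall (g : 'M[R[i]]_N) (B : set (borel_mx R N)), G g -> measurable B ->
    mu [set (g *m (h : 'M[R[i]]_N)) | h in B] = mu B.

Definition haar_random (R : realType) (N : nat) (G : set 'M[R[i]]_N)
    (d : measure_display) (T : measurableType d) (P : probability T R)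
    (A : {RV P >-> borel_mx R N}) : Prop :=
  (forall t, G (A t)) /\ is_haar G (distribution P A).

(* The product rule for a subfamily is the case where the remaining B i are   *)
(* the whole space.                                                           *)
Definition independent (R : realType) (d d' : measure_display)
    (T : measurableType d) (T' : measurableType d') (P : probability T R)
    (I : finType) (X : I -> {RV P >-> T'}) : Prop :=
  forall B : I -> set T', (forall i, measurable (B i)) ->
    P (\bigcap_i (X i @^-1` B i)) = (\prod_i P (X i @^-1` B i))%E.

Definition complex_expectation (R : realType) (d : measure_display)
    (T : measurableType d) (P : probability T R) (X : T -> R[i]) : R[i] :=
  Complex (fine 'E_P[fun t => complex.Re (X t)])
          (fine 'E_P[fun t => complex.Im (X t)]).

(* The rational function f has no pole at x and takes the value v there.      *)
Definition ratfun_value (K : fieldType) (f : {fraction {poly K}}) (x v : K) :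
    Prop :=
  exists p q : {poly K},
    [/\ f = tofrac p / tofrac q, q.[x] != 0 & v = p.[x] / q.[x]].

(* Main.v *)
Require Import Defs.
From HB Require Import structures.
From mathcomp Require Import all_boot all_order all_algebra all_fingroup.
From mathcomp Require Import fraction complex.
From mathcomp Require Import all_classical all_reals all_analysis.
From mathcomp Require Import measurable_realfun.

(** Write G for the group of monomial matrices whose non-zero entries lie in a
set U of complex numbers of modulus 1: the m-th roots of unity or the whole
circle.  Everything below uses only that U contains 1 and lies on the circle.

Let L be the length of w.  The trace of w(A) is the sum, over the labellings f
of the vertices 0, ..., L of a path by row indices with f(0) = f(L), of a
product of L entries of the A_g, conjugated at inverse letters because the
matrices are unitary ([trace_word_eval]).  The expected value of the product
attached to f is computed with two kinds of left translations of the Haar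
measure.

Scaling a row of one A_g by u in U leaves the joint law of the family unchanged
([joint_law_transform]) and multiplies the product by u^p conj(u)^q, where p
and q count the plain and the conjugated factors taken from that row.  So the
expected value vanishes unless u^p conj(u)^q = 1 for all u in U and all rows
([expectation_unbalanced]).  When it is so, the product only takes the values
0 and 1, as a non-zero entry is determined by its row, and its expected value
is the probability that all the entries involved are non-zero.

Translating by permutation matrices shows that the support of A_g is a uniform
random permutation ([haar_support]).  The permutations sending given rows to
given columns number (N - e)! if the prescription is a matching with e edges,
and there are none otherwise ([card_perm_extending]).  By independence the
expected value is thus 0 or the inverse of the product over g of the falling
factorials N (N - 1) ... (N - e_g + 1) ([expectation_balanced]).

That value depends on N and on the kernel of f alone, that is, on which
vertices have equal labels.  There are finitely many kernels, independently
of N, and the labellings with a given kernel of k classes number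
N (N - 1) ... (N - k + 1) ([sum_by_kernel]).  The sum over the kernels is the
wanted rational function [trace_ratfun]; its denominators do not vanish at
N >= L, since e_g <= L. *)

Set Implicit Arguments.
Unset Strict Implicit.
Unset Printing Implicit Defensive.

Import Order.TTheory GRing.Theory Num.Theory.
Import numFieldNormedType.Exports.
Local Open Scope classical_set_scope.
Local Open Scope ring_scope.

(** * Permutations with prescribed values *)

(** By induction on K: a permutation that is right on K minus l is corrected
at l by a transposition, which moves no value already prescribed. *)
Lemma perm_extension (T I : finType) (K : {set I}) (a b : I -> T) :
    {in K &, forall k l, (a k == a l) = (b k == b l)} ->
  exists s : {perm T}, {in K, forall k, s (a k) = b k}.
Proof.
move: {2}#|K| (leqnn #|K|) => n; elim: n K => [|n IH] K leK eqab.
  by exists 1%g => k; move: leK; rewrite leqn0 cards_eq0 => /eqP ->; rewrite inE.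
have [->|[l lK]] := set_0Vmem K; first by exists 1%g => k; rewrite inE.
have [||s sE] := IH (K :\ l)%SET.
- by move: leK; rewrite (cardsD1 l K) lK.
- by move=> i j /setD1P[_ iK] /setD1P[_ jK]; apply: eqab.
exists (s * tperm (s (a l)) (b l))%g => k kK; rewrite permM.
have [ekl|nekl] := eqVneq (a k) (a l).
  by rewrite ekl tpermL; apply/esym/eqP; rewrite -eqab// ekl.
have kKl : k \in K :\ l.
  by rewrite !inE kK andbT; apply: contraNneq nekl => ->.
rewrite (sE k kKl) tpermD//.
- by rewrite -(sE k kKl) (inj_eq perm_inj) eq_sym.
- by rewrite eq_sym -eqab.
Qed.

(** If one permutation fulfils the prescription, those that do form its coset
modulo the permutations supported outside the image of K by a. *)
Lemma card_perm_extending (T I : finType) (K : {set I}) (a b : I -> T) :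
  #|[set s : {perm T} | [forall k in K, s (a k) == b k]]%SET| =
  if [forall k in K, forall l in K, (a k == a l) == (b k == b l)]
  then (#|T| - #|a @: K|)`! else 0%N.
Proof.
case: ifPn => [/forall_inP eqab|neqab]; last first.
  apply/eqP; rewrite cards_eq0; apply: contraNT neqab => /set0Pn[s].
  rewrite inE => /forall_inP sE; apply/forall_inP => k kK.
  apply/forall_inP => l lK.
  by rewrite -(eqP (sE _ kK)) -(eqP (sE _ lK)) (inj_eq perm_inj).
have {}eqab : {in K &, forall k l, (a k == a l) = (b k == b l)}.
  by move=> k l kK lK; have /forall_inP/(_ _ lK)/eqP := eqab _ kK.
have [s0 s0E] := perm_extension eqab.
have -> : (#|T| - #|a @: K| = #|~: (a @: K)%SET|)%N.
  by rewrite -(cardsC (a @: K)) addKn.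
rewrite -card_perm -[RHS](card_imset _ (mulIg s0)); apply: eq_card => s.
rewrite inE; apply/forall_inP/finset.imsetP => [sE|[u]].
  exists (s * s0^-1)%g; last by rewrite mulgKV.
  apply/fintype.subsetP => x; rewrite inE permM => nx; rewrite inE.
  apply: contra nx => /finset.imsetP[k kK ->].
  by rewrite (eqP (sE _ kK)) -s0E// permK.
move=> uP -> k kK; rewrite permM -s0E//; apply/eqP; congr (s0 _).
by apply: (out_perm uP); rewrite inE negbK finset.imset_f.
Qed.

(** * Summing over functions by their kernel *)

Section Kernel.
Variable I : finType.

Definition same_kernel (V W : eqType) (f : I -> V) (g : I -> W) :=
  forall i j, (f i == f j) = (g i == g j).

(** A canonical form of the kernel of f as a map from I to itself: two
functions have the same kernel if and only if they have the same
[kernel_repr], and its fixed points enumerate the kernels without reference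
to the codomain. *)
Definition kernel_repr (V : eqType) (f : I -> V) : {ffun I -> I} :=
  [ffun i => odflt i [pick j | f j == f i]].

Lemma kernel_reprK (V : eqType) (f : I -> V) i : f (kernel_repr f i) = f i.
Proof. by rewrite ffunE; case: pickP => //= j /eqP. Qed.

Lemma eq_kernel_repr (V W : eqType) (f : I -> V) (g : I -> W) :
  same_kernel f g -> kernel_repr f = kernel_repr g.
Proof.
move=> fg; apply/ffunP => i; rewrite !ffunE; congr odflt.
by apply: eq_pick => j; rewrite fg.
Qed.

Lemma same_kernel_repr (V : eqType) (f : I -> V) : same_kernel f (kernel_repr f).
Proof.
move=> i j; apply/eqP/eqP => [fij|]; last first.
  by move/(congr1 f); rewrite !kernel_reprK.
rewrite !ffunE.
rewrite (eq_pick (fun k => _ : (f k == f i) = (f k == f j))); last first.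
  by move=> k; rewrite fij.
by case: pickP => //= /(_ j); rewrite eqxx.
Qed.

Lemma card_imset_same_kernel (V W : finType) (f : I -> V) (g : I -> W)
    (J : finType) (h : J -> I) (A : {set J}) :
  same_kernel f g -> #|(f \o h) @: A| = #|(g \o h) @: A|.
Proof.
suff le (V' W' : finType) (f' : I -> V') (g' : I -> W') :
    same_kernel f' g' -> (#|(f' \o h) @: A| <= #|(g' \o h) @: A|)%N.
  move=> fg; apply/eqP; rewrite eqn_leq !le// => i j; exact/esym/fg.
move=> fg; have [A0|[a0 a0A]] := set_0Vmem A; first by rewrite A0 imset0 cards0.
pose s w := f' (h (odflt a0 [pick a in A | g' (h a) == w])).
rewrite (_ : (f' \o h) @: A = s @: ((g' \o h) @: A)) ?leq_imset_card//.
rewrite -imset_comp; apply: eq_in_imset => a aA /=; rewrite /s.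
case: pickP => [b /andP[_ gb]|/(_ a)] /=; last by rewrite aA eqxx.
by apply/esym/eqP; rewrite fg.
Qed.

(** A function with the kernel of c factors uniquely as c followed by an
injection of the image of c. *)
Lemma card_kernel_class (V : finType) (c : {ffun I -> I}) :
  kernel_repr c = c ->
  #|[set f : {ffun I -> V} | kernel_repr f == c]%SET| =
  (#|V| ^_ #|c @: [set: I]%SET|)%N.
Proof.
move=> cK.
pose J := {x | x \in c @: [set: I]%SET}.
have cJ i : c i \in c @: [set: I]%SET by rewrite finset.imset_f.
(* The inverse of the restriction of a function to the image of c. *)
pose ext (h : {ffun J -> V}) : {ffun I -> V} := [ffun i => h (Sub (c i) (cJ i))].
have cc i : c (c i) = c i by rewrite -{2}cK kernel_reprK.
have ext_inj : injective ext.
  move=> h h' /ffunP eh; apply/ffunP => -[x xJ].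
  have /finset.imsetP[i _ xi] := xJ; have := eh x; rewrite !ffunE.
  by rewrite (_ : Sub _ _ = exist _ x xJ)//; apply: val_inj => /=; rewrite xi cc.
rewrite (_ : #|c @: [set: I]%SET| = #|{: J}|); last first.
  by rewrite card_sig; apply: eq_card => x; rewrite inE.
rewrite -[X in (X ^_ _)%N](cardsT V) -card_inj_ffuns_on -(card_imset _ ext_inj).
apply: eq_card => f; rewrite inE; apply/eqP/finset.imsetP => [fc|[h]]; last first.
  rewrite inE => /andP[_ /injectiveP hinj] ->.
  rewrite -[RHS]cK; apply: eq_kernel_repr => i j; rewrite !ffunE (inj_eq hinj).
  by rewrite -val_eqE.
have fk : same_kernel f c by rewrite -fc; exact: same_kernel_repr.
exists [ffun x : J => f (val x)]; last first.
  by apply/ffunP => i; rewrite !ffunE /= -fc kernel_reprK.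
rewrite inE; apply/andP; split; first by apply/ffun_onP => x; rewrite inE.
apply/injectiveP => -[x xJ] [y yJ]; rewrite !ffunE /= => fxy.
apply: val_inj => /=; move/eqP: fxy; rewrite fk.
have /finset.imsetP[i _ ->] := xJ; have /finset.imsetP[j _ ->] := yJ.
by rewrite !cc => /eqP.
Qed.

(** The index set of the right-hand side does not depend on V, which turns
a sum over functions into N = #|V| into a fixed sum of polynomials in N. *)
Lemma sum_by_kernel (V : finType) (K : pzSemiRingType)
    (F : {ffun I -> V} -> K) (F' : {ffun I -> I} -> K) :
    (forall (f : {ffun I -> V}) (c : {ffun I -> I}),
       same_kernel f c -> F f = F' c) ->
  \sum_f F f =
  \sum_(c : {ffun I -> I} | kernel_repr c == c)
    (#|V| ^_ #|c @: [set: I]%SET|)%:R * F' c.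
Proof.
move=> FF'.
rewrite (partition_big (fun f : {ffun I -> V} => kernel_repr f)
   (fun c => kernel_repr c == c)); last first.
  move=> f _; apply/eqP/esym/eq_kernel_repr; exact: same_kernel_repr.
apply: eq_bigr => c /eqP cK.
rewrite (eq_bigr (fun=> F' c)); last first.
  by move=> f /eqP fc; apply: FF'; rewrite -fc; exact: same_kernel_repr.
rewrite sumr_const mulr_natl; congr (_ *+ _).
by rewrite -card_kernel_class//; apply: eq_card => f; rewrite !inE.
Qed.

End Kernel.

(** * Entries of a product of matrices as sums over paths *)

Lemma big_ffun_recl (R : Type) (idx : R) (op : Monoid.com_law idx)
    (V : finType) n (F : {ffun 'I_n.+1 -> V} -> R) :
  \big[op/idx]_f F f =
  \big[op/idx]_(x : V) \big[op/idx]_(g : {ffun 'I_n -> V})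
     F [ffun i => oapp g x (unlift ord0 i)].
Proof.
rewrite pair_big /=.
rewrite (reindex (fun p : V * {ffun 'I_n -> V} =>
   [ffun i => oapp p.2 p.1 (unlift ord0 i)])) //=.
exists (fun f => (f ord0, [ffun i => f (lift ord0 i)])) => [[x g] _|f _] /=.
  rewrite ffunE unlift_none; congr pair.
  by apply/ffunP => i; rewrite !ffunE liftK.
apply/ffunP => i; rewrite ffunE; case: unliftP => [j ->|->] //=.
by rewrite ffunE.
Qed.

Lemma mulmx_prod_entry (K : comPzSemiRingType) N (I : Type) (w : seq I)
    (M : I -> 'M[K]_N) x y :
  (\big[mulmx/1%:M]_(a <- w) M a) x y =
  \sum_(f : {ffun 'I_(size w).+1 -> 'I_N} | (f ord0 == x) && (f ord_max == y))
    \prod_(k < size w) M (tnth (in_tuple w) k)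
                         (f (widen_ord (leqnSn _) k)) (f (lift ord0 k)).
Proof.
elim: w x => [|a w IH] x.
  rewrite big_nil mxE [RHS]big_mkcond big_ffun_recl /=.
  rewrite (bigD1 x)//= [X in _ + X]big1 ?addr0; last first.
    move=> z zx; apply: big1 => g _.
    by rewrite ffunE unlift_none /= (negbTE zx).
  rewrite (big_pred1 [ffun=> x]); last first.
    by move=> g; apply/esym/eqP/ffunP => -[].
  rewrite !ffunE (_ : ord_max = ord0)//; last exact: val_inj.
  by rewrite unlift_none /= eqxx big_ord0; case: eqP.
rewrite big_cons mxE.
rewrite [RHS]big_mkcond big_ffun_recl /=.
rewrite [RHS](bigD1 x)//= [X in _ = _ + X]big1 ?addr0; last first.
  move=> z zx; apply: big1 => g _.
  by rewrite ffunE unlift_none /= (negbTE zx).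
under eq_bigr => z _ do rewrite IH mulr_sumr.
rewrite (exchange_big_dep
  (fun g : {ffun 'I_(size w).+1 -> 'I_N} => g ord_max == y)) /=; last first.
  by move=> z g _ /andP[].
rewrite [LHS]big_mkcond; apply: eq_bigr => g _.
rewrite !ffunE unlift_none eqxx /=.
have -> : @ord_max (size w).+1 = lift ord0 ord_max by apply: val_inj.
rewrite liftK /=; case: eqP => // gy.
rewrite (big_pred1 (g ord0)); last by move=> z; rewrite andbT eq_sym.
rewrite big_ord_recl; congr *%R.
  rewrite !ffunE liftK (_ : widen_ord _ _ = ord0) ?unlift_none//.
  exact: val_inj.
apply: eq_bigr => k _; rewrite !ffunE liftK /=.
rewrite (_ : widen_ord _ (lift ord0 k) = lift ord0 (widen_ord (leqnSn _) k)).
  by rewrite liftK /= !(tnth_nth a).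
exact: val_inj.
Qed.

(** * Values of rational functions *)

Lemma ratfun_value0 (K : fieldType) (x : K) : ratfun_value 0 x 0.
Proof.
exists 0, 1; split; rewrite ?hornerC ?oner_eq0 ?mul0r//; rewrite rmorph0 mul0r.
Qed.

Lemma ratfun_valueD (K : fieldType) (f g : {fraction {poly K}}) (x u v : K) :
  ratfun_value f x u -> ratfun_value g x v -> ratfun_value (f + g) x (u + v).
Proof.
move=> [p [q [-> qx ->]]] [p' [q' [-> q'x ->]]].
have nz (s : {poly K}) : s.[x] != 0 -> tofrac s != 0.
  by rewrite tofrac_eq0; apply: contraNneq => ->; rewrite horner0.
exists (p * q' + p' * q), (q * q'); split.
- by rewrite rmorphD !rmorphM addf_div ?nz.
- by rewrite hornerM mulf_neq0.
- by rewrite hornerD !hornerM addf_div.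
Qed.

Lemma ratfun_value_sum (K : fieldType) (I : finType) (P : pred I)
    (f : I -> {fraction {poly K}}) (x : K) (v : I -> K) :
    (forall i, P i -> ratfun_value (f i) x (v i)) ->
  ratfun_value (\sum_(i | P i) f i) x (\sum_(i | P i) v i).
Proof.
move=> fv; elim/big_rec2: _ => [|i u g Pi gu]; first exact: ratfun_value0.
exact/ratfun_valueD/gu/fv.
Qed.

Definition ffact_poly k : {poly rat} := \prod_(i < k) ('X - i%:R%:P).

Lemma horner_ffact_poly k N : (ffact_poly k).[N%:R] = (N ^_ k)%:R.
Proof.
rewrite horner_prod (eq_bigr (fun i : 'I_k => N%:R - i%:R)); last first.
  by move=> i _; rewrite hornerXsubC.
elim: k => [|k IH]; first by rewrite big_ord0.
rewrite big_ord_recr /= IH ffactnSr natrM.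
have [kN|Nk] := leqP k N; first by rewrite natrB.
by rewrite ffact_small// !mul0r.
Qed.

(** * The contribution of a labelled path *)

Section Patterns.
Variables (r : nat) (w : seq (letter r)) (bal : nat -> nat -> bool).

(** The k-th letter of w is the edge from vertex k to vertex k+1 of a path. *)
Definition vertex := 'I_(size w).+1.
Definition letter_at (k : 'I_(size w)) : letter r := tnth (in_tuple w) k.

(** For matrices with inverse equal to their conjugate transpose, the entry of
an inverse letter along an edge is the conjugate of the entry of the generator
along the reversed edge.  So the vertex giving the row of the generator is the
end of the edge at an inverse letter and its origin otherwise. *)
Definition row_vertex (k : 'I_(size w)) : vertex :=
  if (letter_at k).2 then lift ord0 k else widen_ord (leqnSn _) k.
Definition col_vertex (k : 'I_(size w)) : vertex :=
  if (letter_at k).2 then widen_ord (leqnSn _) k else lift ord0 k.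

Definition letters_of (g : 'I_r) : {set 'I_(size w)} :=
  [set k | (letter_at k).1 == g]%SET.

Section Labelled.
Variables (V : finType) (f : vertex -> V).

(** The number of factors taken from the same row of the same generator as the
factor k, either plain (b = false) or conjugated (b = true). *)
Definition row_count (b : bool) (k : 'I_(size w)) : nat :=
  #|[set l | (letter_at l == ((letter_at k).1, b)) &
             (f (row_vertex l) == f (row_vertex k))]%SET|.

Definition balanced : bool :=
  [forall k, bal (row_count false k) (row_count true k)].

Definition matching : bool :=
  [forall g, forall k in letters_of g, forall l in letters_of g,
     (f (row_vertex k) == f (row_vertex l)) ==
     (f (col_vertex k) == f (col_vertex l))].

Definition edge_count (g : 'I_r) : nat := #|(f \o row_vertex) @: letters_of g|.

Definition contributes : bool :=
  [&& f ord0 == f ord_max, balanced & matching].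

End Labelled.

(** When bal is [entries_cancel] and V has N elements, this is the expected value
of the product of entries along a closed path f, by [expectation_balanced] and
[expectation_unbalanced].  Open paths do not occur in the trace. *)
Definition pattern_weight (V : finType) (f : vertex -> V) (N : nat) : rat :=
  if contributes f then (\prod_(g < r) (N ^_ edge_count f g)%:R)^-1 else 0.

Lemma pattern_weight_kernel (V W : finType) (f : vertex -> V) (g : vertex -> W) N :
  same_kernel f g -> pattern_weight f N = pattern_weight g N.
Proof.
move=> fg; rewrite /pattern_weight /contributes fg.
have -> : balanced f = balanced g.
  apply: eq_forallb => k; congr bal; apply: eq_card => l; by rewrite !inE fg.
have -> : matching f = matching g.
  apply: eq_forallb => a; apply: eq_forallb => k; congr implb.
  by apply: eq_forallb => l; rewrite !fg.
case: ifP => // _; congr (_^-1); apply: eq_bigr => a _.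
by rewrite /edge_count (card_imset_same_kernel _ _ fg).
Qed.

Definition trace_ratfun : {fraction {poly rat}} :=
  \sum_(c : {ffun vertex -> vertex} | (kernel_repr c == c) && contributes c)
    tofrac (ffact_poly #|c @: [set: vertex]%SET|) /
    tofrac (\prod_(g < r) ffact_poly (edge_count c g)).

Lemma edge_count_le (V : finType) (f : vertex -> V) g :
  (edge_count f g <= size w)%N.
Proof.
by rewrite (leq_trans (leq_imset_card _ _))// (leq_trans (max_card _))// card_ord.
Qed.

Lemma trace_ratfunP N : (size w <= N)%N ->
  ratfun_value trace_ratfun N%:R
    (\sum_(f : {ffun vertex -> 'I_N}) pattern_weight f N).
Proof.
move=> wN.
rewrite (sum_by_kernel (F' := fun c => pattern_weight c N)); last first.
  move=> f c; exact: pattern_weight_kernel.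
rewrite (bigID (fun c : {ffun vertex -> vertex} => contributes c)) /=.
rewrite [X in _ + X]big1 ?addr0; last first.
  by move=> c /andP[_ /negbTE nc]; rewrite /pattern_weight nc mulr0.
apply: ratfun_value_sum => c /andP[_ cc].
exists (ffact_poly #|c @: [set: vertex]%SET|),
  (\prod_(g < r) ffact_poly (edge_count c g)).
have val : (\prod_(g < r) ffact_poly (edge_count c g)).[N%:R] =
    \prod_(g < r) (N ^_ edge_count c g)%:R :> rat.
  by rewrite horner_prod; apply: eq_bigr => g _; rewrite horner_ffact_poly.
split => //; rewrite val.
  apply/prodf_neq0 => g _.
  by rewrite pnatr_eq0 -lt0n ffact_gt0 (leq_trans (edge_count_le _ _)).
by rewrite horner_ffact_poly card_ord /pattern_weight cc.
Qed.

End Patterns.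

(** * The joint law of independent variables *)

Section JointLaw.
Context (R : realType) (d d' : measure_display) (T : measurableType d)
  (T' : measurableType d') (P : probability T R) (I : finType).

(** The product sigma-algebra on families indexed by I is the one generated by
these boxes, which form a pi-system. *)
Definition boxes : set (set (I -> T')) :=
  [set [set h | forall i, B i (h i)] | B in
    [set B : I -> set T' | forall i, measurable (B i)]].

Definition joint_space : measurableType _ := g_sigma_algebraType boxes.

Lemma measurable_coord (i : I) :
  measurable_fun setT (fun h : joint_space => h i).
Proof.
move=> _ B mB; rewrite setTI; apply: sub_sigma_algebra.
exists (fun j => if j == i then B else setT).
  by move=> j; case: ifP => // _; exact: measurableT.
apply/seteqP; split => h /=; first by move/(_ i); rewrite eqxx.
by move=> Bh j; case: eqP => // ->.
Qed.

Lemma measurable_joint (X : I -> T -> T') :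
  (forall i, measurable_fun setT (X i)) ->
  measurable_fun setT ((fun t i => X i t) : T -> joint_space).
Proof.
move=> mX.
apply: (@measurability _ _ T joint_space setT _ boxes) => // _ [_ [B mB <-] <-].
rewrite setTI (_ : _ @^-1` _ = \bigcap_(i in [set: I]) (X i @^-1` B i)).
  apply: fin_bigcap_measurable => // i _.
  by rewrite -[X in measurable X]setTI; exact: mX.
by apply/seteqP; split => t /=; [move=> h i _; exact: h|move=> h i; exact: h].
Qed.

(** Both laws are probability measures on the joint space, and independence
makes them agree on boxes: they are equal by the uniqueness of a finite measure
with prescribed values on a generating pi-system. *)
Lemma joint_law_transform (X : I -> {RV P >-> T'}) (g : I -> T' -> T') :
    independent X -> (forall i, measurable_fun setT (g i)) ->
    (forall i B, measurable B -> P (X i @^-1` (g i @^-1` B)) = P (X i @^-1` B)) ->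
  forall E : set joint_space, measurable E ->
    P ((fun t i => g i (X i t)) @^-1` E) = P ((fun t i => X i t) @^-1` E).
Proof.
move=> indX mg gX.
have mX : measurable_fun setT ((fun t i => X i t) : T -> joint_space).
  exact: measurable_joint.
have mgX : measurable_fun setT ((fun t i => g i (X i t)) : T -> joint_space).
  by apply: measurable_joint => i; apply: measurableT_comp.
pose X1 : {mfun T >-> joint_space} := HB.pack (fun t i => X i t : T')
  (isMeasurableFun.Build _ _ T joint_space _ mX).
pose X2 : {mfun T >-> joint_space} := HB.pack (fun t i => g i (X i t) : T')
  (isMeasurableFun.Build _ _ T joint_space _ mgX).
apply: (@g_sigma_algebra_measure_unique _ _ joint_space boxes _ (fun=> setT)
  _ _ (distribution P X2) (distribution P X1)).
- exact: sub_sigma_algebra.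
- move=> _; exists (fun=> setT) => [i|]; first exact: measurableT.
  by apply/seteqP; split.
- by rewrite bigcup_const//; exists 0%N.
- move=> _ _ [B mB <-] [C mC <-]; exists (fun i => B i `&` C i).
    by move=> i; exact: measurableI.
  apply/seteqP; split => h /= H; first by split=> i; case: (H i).
  by case: H => HB HC i; split; [exact: HB|exact: HC].
- move=> _ [B mB <-].
  have boxE (Y : I -> T -> T') (C : I -> set T') :
      (fun t i => Y i t) @^-1` [set h | forall i, C i (h i)] =
      \bigcap_i (Y i @^-1` C i).
    by apply/seteqP; split => t /=; [move=> h i _; exact: h|move=> h i; exact: h].
  transitivity (P (\bigcap_i (X i @^-1` (g i @^-1` B i)))).
    by congr (P _); exact: (boxE (fun i t => g i (X i t))).
  transitivity (P (\bigcap_i (X i @^-1` B i))); last first.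
    by congr (P _); apply/esym; exact: (boxE (fun i t => X i t)).
  rewrite (indX B mB) -(eq_bigr _ (fun i _ => gX i (B i) (mB i))) -indX//.
  by move=> i; rewrite -[X in measurable X]setTI; exact: mg.
- move=> n; rewrite (@le_lt_trans _ _ 1%E)// ?ltry//.
  by apply: probability_le1.
Qed.

End JointLaw.

(** * Measurability of functions of a matrix *)

Section MatrixEntries.
Context (R : realType) (N : nat).

Lemma continuous_measurable_borel_mx (f : 'M[R[i]^o]_N -> R) :
  continuous f -> measurable_fun setT (f : borel_mx R N -> R).
Proof.
move=> cf; apply: (measurability _ (RGenOpens.measurableE R)).
move=> _ [_ [a [b ->]] <-].
rewrite setTI; apply: sub_sigma_algebra => /=.
by apply: open_comp; [move=> x _; exact: cf|exact: interval_open].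
Qed.

Lemma continuous_mx_measurable (f : 'M[R[i]^o]_N -> 'M[R[i]^o]_N) :
  continuous f -> measurable_fun setT (f : borel_mx R N -> borel_mx R N).
Proof.
move=> cf.
apply: (@measurability _ _ (borel_mx R N) (borel_mx R N) setT f
  [set U : set 'M[R[i]^o]_N | open U]) => // _ [U oU <-].
rewrite setTI; apply: sub_sigma_algebra => /=.
by apply: open_comp => // x _; exact: cf.
Qed.

Lemma continuous_mx (f : 'M[R[i]^o]_N -> 'M[R[i]^o]_N) :
  (forall i j, continuous (fun M => f M i j : R[i]^o)) -> continuous f.
Proof.
move=> cf M A [Q MQ sQA].
have FM : Filter (f @ M) by apply: fmap_filter; exact: nbhs_filter.
apply: (@filterS _ (f @ M) FM _ _ sQA).
refine (@filter_forall _ _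
  (fun i (M' : 'M[R[i]^o]_N) => forall j, Q i j (M' i j)) _ FM _) => i.
refine (@filter_forall _ _
  (fun j (M' : 'M[R[i]^o]_N) => Q i j (M' i j)) _ FM _) => j.
exact: (cf i j M).
Qed.

Lemma continuous_Re : continuous (@complex.Re R : R[i]^o -> R).
Proof.
move=> z A /nbhs_ballP[e /= e0 eA]; apply/nbhs_ballP; exists (e%:C)%C.
  by rewrite /= ltcR.
move=> y /= zy; apply: eA; rewrite /ball /= -ltcR.
rewrite (le_lt_trans _ zy)// -raddfB; exact: normc_ge_Re.
Qed.

Lemma continuous_Im : continuous (@complex.Im R : R[i]^o -> R).
Proof.
move=> z A /nbhs_ballP[e /= e0 eA]; apply/nbhs_ballP; exists (e%:C)%C.
  by rewrite /= ltcR.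
move=> y /= zy; apply: eA; rewrite /ball /= -ltcR.
rewrite (le_lt_trans _ zy)// -raddfB.
case: (z - y) => a b; simpc; rewrite -sqrtr_sqr ler_wsqrtr // lerDr.
exact: sqr_ge0.
Qed.

End MatrixEntries.

(** * Expected values of complex random variables *)

Section ComplexMeasurable.
Context (R : realType) (d : measure_display) (T : measurableType d).

Definition cmeasurable (X : T -> R[i]) : Prop :=
  measurable_fun setT (fun t => complex.Re (X t)) /\
  measurable_fun setT (fun t => complex.Im (X t)).

Lemma cmeasurable_cst (c : R[i]) : cmeasurable (fun=> c).
Proof. by split; exact: measurable_cst. Qed.

Lemma cmeasurableM (X Y : T -> R[i]) :
  cmeasurable X -> cmeasurable Y -> cmeasurable (fun t => X t * Y t).
Proof.
move=> [X1 X2] [Y1 Y2]; split.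
  rewrite (_ : (fun _ => _) = (fun t => complex.Re (X t) * complex.Re (Y t) -
    complex.Im (X t) * complex.Im (Y t))).
    by apply: measurable_funB; exact: measurable_funM.
  by apply/funext => t; case: (X t) => a b; case: (Y t).
rewrite (_ : (fun _ => _) = (fun t => complex.Re (X t) * complex.Im (Y t) +
    complex.Im (X t) * complex.Re (Y t))).
  by apply: measurable_funD; exact: measurable_funM.
by apply/funext => t; case: (X t) => a b; case: (Y t).
Qed.

Lemma cmeasurable_conj (X : T -> R[i]) :
  cmeasurable X -> cmeasurable (fun t => (X t)^*%C).
Proof.
move=> [X1 X2]; split.
  by rewrite (_ : (fun _ => _) = (fun t => complex.Re (X t)))//;
    apply/funext => t; case: (X t).
rewrite (_ : (fun _ => _) = (fun t => - complex.Im (X t))).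
  exact: measurableT_comp.
by apply/funext => t; case: (X t).
Qed.

Lemma cmeasurable_prod (I : Type) (s : seq I) (X : I -> T -> R[i]) :
  (forall i, cmeasurable (X i)) ->
  cmeasurable (fun t => \prod_(i <- s) X i t).
Proof.
move=> mX; elim: s => [|i s IH].
  by under eq_fun do rewrite big_nil; exact: cmeasurable_cst.
by under eq_fun do rewrite big_cons; exact: cmeasurableM.
Qed.

End ComplexMeasurable.

Lemma cmeasurable_comp (R : realType) (d d' : measure_display)
    (T : measurableType d) (T' : measurableType d') (g : T' -> T)
    (X : T -> R[i]) :
  measurable_fun setT g -> cmeasurable X -> cmeasurable (fun t => X (g t)).
Proof.
by move=> mg [X1 X2]; split;
  [exact: (measurableT_comp X1 mg)|exact: (measurableT_comp X2 mg)].
Qed.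

Section ComplexIntegrable.
Context (R : realType) (d : measure_display) (T : measurableType d)
  (P : probability T R).

Definition cintegrable (X : T -> R[i]) : Prop :=
  P.-integrable setT (fun t => (complex.Re (X t))%:E) /\
  P.-integrable setT (fun t => (complex.Im (X t))%:E).

Lemma cmeasurable_integrable (X : T -> R[i]) :
  cmeasurable X -> (forall t, `|X t| <= 1) -> cintegrable X.
Proof.
move=> [X1 X2] leX.
have bnd (f : T -> R) : measurable_fun setT f -> (forall t, `|f t| <= 1) ->
    P.-integrable setT (fun t => (f t)%:E).
  move=> mf f1; apply: (@le_integrable _ _ _ _ _ measurableT _ (fun=> 1%:E)) => //=.
  - exact/measurable_EFinP.
  - by move=> t _; rewrite lee_fin normr1.
  - exact: finite_measure_integrable_cst.
split; apply: bnd => // t; rewrite -lecR (le_trans _ (leX t))//.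
  exact: normc_ge_Re.
by case: (X t) => a b; simpc; rewrite -sqrtr_sqr ler_wsqrtr // lerDr sqr_ge0.
Qed.

Lemma cintegrable0 : cintegrable (fun=> 0).
Proof. by split => /=; exact: integrable0. Qed.

Lemma cintegrableD (X Y : T -> R[i]) :
  cintegrable X -> cintegrable Y -> cintegrable (fun t => X t + Y t).
Proof.
move=> [X1 X2] [Y1 Y2]; split.
  by under eq_fun do rewrite raddfD/= EFinD; exact: integrableD.
by under eq_fun do rewrite raddfD/= EFinD; exact: integrableD.
Qed.

Lemma cintegrable_sum (I : Type) (s : seq I) (Q : pred I) (X : I -> T -> R[i]) :
  (forall i, cintegrable (X i)) ->
  cintegrable (fun t => \sum_(i <- s | Q i) X i t).
Proof.
move=> iX; elim: s => [|i s IH].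
  by under eq_fun do rewrite big_nil; exact: cintegrable0.
under eq_fun do rewrite big_cons; case: (Q i) => //; exact: cintegrableD.
Qed.

Lemma complex_expectationD (X Y : T -> R[i]) :
  cintegrable X -> cintegrable Y ->
  complex_expectation P (fun t => X t + Y t) =
  complex_expectation P X + complex_expectation P Y.
Proof.
move=> [X1 X2] [Y1 Y2]; rewrite /complex_expectation unlock; simpc.
congr Complex; rewrite -fineD ?integrable_fin_num// -integralD_EFin//;
  congr fine; apply: eq_integral => t _ /=; by rewrite raddfD.
Qed.

Lemma complex_expectation_cst c : complex_expectation P (fun=> c) = c.
Proof. by rewrite /complex_expectation !expectation_cst; case: c. Qed.

Lemma complex_expectation_sum (I : Type) (s : seq I) (Q : pred I)
    (X : I -> T -> R[i]) : (forall i, cintegrable (X i)) ->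
  complex_expectation P (fun t => \sum_(i <- s | Q i) X i t) =
  \sum_(i <- s | Q i) complex_expectation P (X i).
Proof.
move=> iX; elim: s => [|i s IH].
  rewrite big_nil -[RHS](complex_expectation_cst 0); congr complex_expectation.
  by apply/funext => t; rewrite big_nil.
rewrite big_cons; under [in LHS]eq_fun do rewrite big_cons; case: (Q i) => //.
by rewrite complex_expectationD ?IH//; exact: cintegrable_sum.
Qed.

Lemma complex_expectationZ (c : R[i]) (X : T -> R[i]) :
  cintegrable X ->
  complex_expectation P (fun t => c * X t) = c * complex_expectation P X.
Proof.
case: c => a b [X1 X2]; rewrite /complex_expectation unlock; simpc.
have i1 := integrable_fin_num measurableT X1.
have i2 := integrable_fin_num measurableT X2.
congr Complex.
  transitivity (fine (\int[P]_t (a%:E * (complex.Re (X t))%:E +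
                                 (- b)%:E * (complex.Im (X t))%:E))%E).
    congr fine; apply: eq_integral => t _; rewrite -!EFinM -EFinD; congr EFin.
    by case: (X t) => x y /=; rewrite mulNr.
  rewrite integralD//; [|exact: integrableZl..].
  by rewrite !(integralZl measurableT)// fineD ?fin_numM// !fineM//= mulNr.
transitivity (fine (\int[P]_t (a%:E * (complex.Im (X t))%:E +
                                 b%:E * (complex.Re (X t))%:E))%E).
  congr fine; apply: eq_integral => t _; rewrite -!EFinM -EFinD; congr EFin.
  by case: (X t) => x y.
rewrite integralD//; [|exact: integrableZl..].
by rewrite !(integralZl measurableT)// fineD ?fin_numM// !fineM.
Qed.

Lemma cintegrable_indic (E : set T) : measurable E ->
  cintegrable (fun t => (t \in E)%:R).
Proof.
move=> mE; apply: cmeasurable_integrable => [|t].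
  split; last first.
    rewrite (_ : (fun t => _) = fun=> 0); first exact: measurable_cst.
    by apply/funext => t; case: (t \in E).
  rewrite (_ : (fun t => _) = \1_E); first exact: measurable_indic.
  by apply/funext => t; rewrite indicE; case: (t \in E).
by case: (t \in E); rewrite ?normr1 ?normr0.
Qed.

Lemma complex_expectation_indic (E : set T) : measurable E ->
  complex_expectation P (fun t => (t \in E)%:R) = ((fine (P E))%:C)%C.
Proof.
move=> mE; rewrite /complex_expectation unlock; congr Complex.
  rewrite -[in RHS](setIT E) -(integral_indic P measurableT mE); congr fine.
  apply: eq_integral => t _; rewrite indicE; by case: (t \in E).
rewrite (eq_integral (fun=> 0%E)) ?integral0// => t _.
by case: (t \in E).
Qed.

Lemma complex_expectation_same_law d' (S : measurableType d') (Y Z : T -> S)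
    (X : S -> R[i]) :
    measurable_fun setT Y -> measurable_fun setT Z -> cmeasurable X ->
    cintegrable (X \o Y) -> cintegrable (X \o Z) ->
    (forall E, measurable E -> P (Y @^-1` E) = P (Z @^-1` E)) ->
  complex_expectation P (X \o Y) = complex_expectation P (X \o Z).
Proof.
move=> mY mZ [X1 X2] [Y1 Y2] [Z1 Z2] law.
pose Y' : {mfun T >-> S} := HB.pack Y (isMeasurableFun.Build _ _ T S _ mY).
pose Z' : {mfun T >-> S} := HB.pack Z (isMeasurableFun.Build _ _ T S _ mZ).
have same (f : S -> R) : measurable_fun setT f ->
    P.-integrable setT (fun t => (f (Y t))%:E) ->
    P.-integrable setT (fun t => (f (Z t))%:E) ->
    (\int[P]_t (f (Y t))%:E = \int[P]_t (f (Z t))%:E)%E.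
  move=> /measurable_EFinP mf iY iZ.
  rewrite -(@integral_distribution _ _ _ _ _ P Y' (EFin \o f))//.
  rewrite -(@integral_distribution _ _ _ _ _ P Z' (EFin \o f))//.
  by apply: eq_measure_integral => E mE _; exact: law.
rewrite /complex_expectation unlock; congr Complex; congr fine;
  [exact: same X1 Y1 Z1|exact: same X2 Y2 Z2].
Qed.

End ComplexIntegrable.

(** * Monomial matrices *)

Lemma monomial_support (K : pzRingType) N (A : 'M[K]_N) : monomial_mx A ->
  exists s : {perm 'I_N}, forall i j, (A i j != 0) = (s i == j).
Proof.
move=> [rowA colA].
have /choice[s sP] i : exists j, A i j != 0 /\ forall j', A i j' != 0 -> j = j'.
  by have [j [Aj ju]] := rowA i; exists j.
have s_inj : injective s.
  move=> i i' e; have [k [_ ku]] := colA (s i).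
  rewrite -(ku i (sP i).1); apply: ku; rewrite e; exact: (sP i').1.
exists (perm s_inj) => i j; rewrite permE; apply/idP/eqP => [|<-].
  exact: (sP i).2.
exact: (sP i).1.
Qed.

Section EntryGroups.
Context (R : realType).
Implicit Types U : set R[i].

Definition monomial_over U N : set 'M[R[i]]_N :=
  [set A | monomial_mx A /\ forall i j, A i j != 0 -> U (A i j)].

Lemma diag_monomial_over U N (d : 'I_N -> R[i]) :
  (forall i, U (d i)) -> (forall i, d i != 0) ->
  monomial_over U (diag_mx (\row_i d i)).
Proof.
move=> dU dN0.
have dE i j : diag_mx (\row_i d i) i j = if i == j then d i else 0.
  by rewrite !mxE; case: eqP => // <-.
have dE0 i j : (diag_mx (\row_i d i) i j != 0) = (i == j).
  by rewrite dE; case: (i == j); rewrite ?eqxx /= ?dN0 ?eqxx.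
split; last first.
  by move=> i j; rewrite dE0 => /eqP <-; rewrite dE eqxx.
split=> i; exists i; split; rewrite ?dE0 ?eqxx //.
  by move=> j; rewrite dE0 => /eqP.
by move=> j; rewrite dE0 => /eqP.
Qed.

Lemma perm_monomial_over U N (s : {perm 'I_N}) : U 1 ->
  monomial_over U (perm_mx s).
Proof.
move=> U1.
have pE0 i j : (perm_mx s i j != 0 :> R[i]) = (s i == j).
  by rewrite !mxE; case: (s i == j); rewrite ?oner_eq0 ?eqxx.
split; last first.
  by move=> i j; rewrite pE0 => /eqP <-; rewrite !mxE eqxx.
split=> i.
  exists (s i); split; first by rewrite pE0.
  by move=> j; rewrite pE0 => /eqP.
exists (s^-1%g i); split; first by rewrite pE0 permKV.
by move=> j; rewrite pE0 => /eqP <-; rewrite permK.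
Qed.

(** Monomial matrices with entries on the circle are unitary. *)
Lemma invmx_monomial_over U N (A : 'M[R[i]]_N) i j :
  (forall u, U u -> `|u| = 1) -> monomial_over U A ->
  invmx A i j = (A j i)^*%C.
Proof.
move=> U1 [/monomial_support[s sE] AU].
pose B : 'M[R[i]]_N := \matrix_(i, j) ((A j i)^*%C).
suff AB : A *m B = 1%:M.
  have uA : A \in unitmx by have [] := mulmx1_unit AB.
  by rewrite -[invmx A]mulmx1 -AB mulKmx// mxE.
apply/matrixP => a b; rewrite !mxE (bigD1 (s a))//= big1 ?addr0; last first.
  move=> k ks; rewrite (_ : A a k = 0) ?mul0r//; apply/eqP.
  by apply: contraNT ks; rewrite sE eq_sym.
rewrite mxE; have [<-|nab] := eqVneq a b.
  by rewrite -sqr_normc U1 ?expr1n//; apply: AU; rewrite sE.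
rewrite (_ : A b (s a) = 0) ?conjc0 ?mulr0//; apply/eqP.
by apply: contraNT nab; rewrite sE (inj_eq perm_inj) eq_sym.
Qed.

End EntryGroups.

(** * The law of a Haar random monomial matrix *)

Section HaarMarginals.
Context (R : realType) (U : set R[i]) (N : nat).
Hypothesis U1 : U 1.
Hypothesis normU : forall u, U u -> `|u| = 1.

Let Uneq0 u : U u -> u != 0.
Proof. by move=> /normU u1; rewrite -normr_gt0 u1. Qed.

Lemma cmeasurable_entry i j :
  cmeasurable (fun M : borel_mx R N => (M : 'M[R[i]]_N) i j).
Proof.
split; apply: continuous_measurable_borel_mx => M.
  apply: (@continuous_comp _ _ _ (fun M : 'M[R[i]^o]_N => M i j : R[i]^o)
    (@complex.Re R)); [exact: (@coord_continuous R[i])|exact: continuous_Re].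
apply: (@continuous_comp _ _ _ (fun M : 'M[R[i]^o]_N => M i j : R[i]^o)
  (@complex.Im R)); [exact: (@coord_continuous R[i])|exact: continuous_Im].
Qed.

Definition scale_row (x : 'I_N) (u : R[i]) (M : 'M[R[i]]_N) : 'M[R[i]]_N :=
  diag_mx (\row_i (if i == x then u else 1)) *m M.

Lemma scale_rowE x u M i j :
  scale_row x u M i j = (if i == x then u else 1) * M i j.
Proof. by rewrite /scale_row mul_diag_mx !mxE. Qed.

Lemma measurable_scale_row x u :
  measurable_fun setT (scale_row x u : borel_mx R N -> borel_mx R N).
Proof.
apply: continuous_mx_measurable; apply: continuous_mx => i j M.
rewrite (_ : (fun _ => _) =
    (fun z : R[i]^o => (if i == x then u else 1) *: z) \o
    (fun M : 'M[R[i]^o]_N => M i j)).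
  by apply: continuous_comp;
    [exact: (@coord_continuous R[i])|exact: scaler_continuous].
by apply/funext => M'; rewrite scale_rowE.
Qed.

Context (d : measure_display) (T : measurableType d) (P : probability T R)
  (X : {RV P >-> borel_mx R N}).
Hypothesis haarX : haar_random (monomial_over U (N := N)) X.

Lemma haar_scale_row x u (B : set (borel_mx R N)) : U u -> measurable B ->
  P (X @^-1` (scale_row x u @^-1` B)) = P (X @^-1` B).
Proof.
move=> Uu mB; have [_ [_ inv]] := haarX.
pose D : 'M[R[i]]_N := diag_mx (\row_i (if i == x then u else 1)).
have mB' : measurable (scale_row x u @^-1` B : set (borel_mx R N)).
  by rewrite -[X in measurable X]setTI; exact: measurable_scale_row.
have GD : monomial_over U D.
  by apply: diag_monomial_over => i; case: ifP => // _; rewrite ?oner_eq0 ?Uneq0.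
rewrite -[LHS]/(distribution P X _) -(inv D _ GD mB').
(* B is the translate of its preimage, as the scaling is invertible. *)
congr (P (X @^-1` _)); apply/seteqP; split => [_ [h Bh <-]//|h Bh].
have K : cancel (scale_row x u^-1) (scale_row x u).
  move=> M; apply/matrixP => i j; rewrite !scale_rowE mulrA.
  by case: ifP => _; rewrite ?divff ?Uneq0// !mul1r.
by exists (scale_row x u^-1 h); [rewrite /preimage /= K|exact: K].
Qed.

Definition support_event (s : {perm 'I_N}) : set (borel_mx R N) :=
  [set M : 'M[R[i]]_N | forall i, M i (s i) != 0].

Lemma measurable_entry_neq0 i j :
  measurable ([set M : 'M[R[i]]_N | M i j != 0] : set (borel_mx R N)).
Proof.
have [mRe mIm] := cmeasurable_entry i j.
rewrite (_ : [set M | _] =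
  (fun M : borel_mx R N => complex.Re ((M : 'M[R[i]]_N) i j)) @^-1` (~` [set 0])
  `|` (fun M : borel_mx R N => complex.Im ((M : 'M[R[i]]_N) i j)) @^-1` (~` [set 0])).
  have m0 : measurable (~` [set (0 : R)]) by exact: measurableC.
  by apply: measurableU; rewrite -[X in measurable X]setTI; [exact: mRe|exact: mIm].
apply/seteqP; split => M /=; rewrite eq_complex /= negb_and.
  by move=> /orP[] /eqP; [left|right].
by move=> [] /eqP; [move=> ->|move=> -> ; rewrite orbT].
Qed.

Lemma measurable_all_neq0 (I : finType) (K : {set I}) (a b : I -> 'I_N) :
  measurable ([set M : 'M[R[i]]_N | forall k, k \in K -> M (a k) (b k) != 0]
    : set (borel_mx R N)).
Proof.
rewrite (_ : [set M | _] =
  \bigcap_(k in [set k | k \in K]) [set M : 'M[R[i]]_N | M (a k) (b k) != 0]).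
  by apply: fin_bigcap_measurable => // k _; exact: measurable_entry_neq0.
by apply/seteqP; split => M.
Qed.

Lemma measurable_support_event s : measurable (support_event s).
Proof.
have := @measurable_all_neq0 'I_N [set: 'I_N]%SET id s.
congr measurable; apply/seteqP; split => M /= h i; last by move=> _; exact: h.
by apply: h; rewrite inE.
Qed.

Let msupp s : measurable (X @^-1` support_event s).
Proof.
by rewrite -[X in measurable X]setTI; apply: measurable_funP => //;
   exact: measurable_support_event.
Qed.

(** The events that the support is s, for s a permutation, form a partition. *)
Lemma support_event_sum (Q : pred {perm 'I_N}) t :
  exists s : {perm 'I_N}, (forall i j, ((X t : 'M[R[i]]_N) i j != 0) = (s i == j)) /\
  (\sum_(s' | Q s') (t \in X @^-1` support_event s')%:R = (Q s)%:R :> R[i]).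
Proof.
have [monX _] := haarX.1 t.
have [s sE] := monomial_support monX; exists s; split=> //.
have suppE s' : (t \in X @^-1` support_event s') = (s' == s).
  apply/idP/eqP => [|->].
    rewrite inE /preimage /= /support_event /= => h; apply/permP => i.
    by apply/esym/eqP; rewrite -sE.
  by rewrite inE /preimage /= /support_event /= => i; rewrite sE.
under eq_bigr do rewrite suppE.
rewrite big_mkcond (bigD1 s)//= eqxx big1 ?addr0; first by case: (Q s).
by move=> s' /negbTE ->; case: (Q s').
Qed.

(** Multiplication by permutation matrices acts transitively on the possible
supports, so these are equally likely. *)
Lemma haar_support s : fine (P (X @^-1` support_event s)) = N`!%:R^-1.
Proof.
have inv s' : P (X @^-1` support_event s') = P (X @^-1` support_event 1%g).
  have [_ [_ inv]] := haarX.
  rewrite -[RHS]/(distribution P X _).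
  have PU := @perm_monomial_over R U N s' U1.
  rewrite -(inv _ _ PU (measurable_support_event 1%g)).
  congr (P (X @^-1` _)); apply/seteqP; split => [h Sh|_ [h Sh <-] i].
    exists (perm_mx (s'^-1%g) *m h : 'M[R[i]]_N); last first.
      by rewrite mulmxA -perm_mxM mulgV perm_mx1 mul1mx.
    move=> i; rewrite -row_permE mxE perm1.
    by have := Sh ((s'^-1%g : {perm _}) i); rewrite permKV.
  by rewrite -row_permE mxE; have := Sh (s' i); rewrite perm1.
have sum1 : \sum_(s' : {perm 'I_N}) complex_expectation P
    (fun t => (t \in X @^-1` support_event s')%:R) = 1.
  rewrite -complex_expectation_sum; last first.
    by move=> s'; exact: cintegrable_indic.
  rewrite (_ : (fun t => _) = (fun=> 1)).
    exact: complex_expectation_cst.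
  by apply/funext => t; have [s' [_ ->]] := support_event_sum predT t.
move: sum1.
under eq_bigr do rewrite complex_expectation_indic// inv -(inv s).
rewrite sumr_const => /(congr1 (@complex.Re R)); rewrite raddfMn /=.
rewrite card_Sn => h.
have fact_neq0 : N`!%:R != 0 :> R by rewrite pnatr_eq0 -lt0n fact_gt0.
apply: (mulIf fact_neq0).
by rewrite mulr_natr h mulVf.
Qed.

Lemma haar_all_neq0 (I : finType) (K : {set I}) (a b : I -> 'I_N) :
  fine (P (X @^-1` [set M : 'M[R[i]]_N | forall k, k \in K -> M (a k) (b k) != 0]))
  = #|[set s : {perm 'I_N} | [forall k in K, s (a k) == b k]]%SET|%:R / N`!%:R.
Proof.
set E := X @^-1` _.
have mE : measurable E.
  rewrite -[X in measurable X]setTI; apply: measurable_funP => //.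
  exact: measurable_all_neq0.
apply: (@complexI R); rewrite -complex_expectation_indic//.
pose Q (s : {perm 'I_N}) := [forall k in K, s (a k) == b k].
rewrite (_ : (fun t => _) = fun t =>
    \sum_(s | Q s) (t \in X @^-1` support_event s)%:R); last first.
  apply/funext => t; have [s [sE ->]] := support_event_sum Q t.
  congr (_%:R); congr nat_of_bool; apply/idP/forall_inP => [|h].
    by rewrite inE => h k /h; rewrite sE.
  by rewrite inE => k kK; rewrite sE; exact: h.
rewrite complex_expectation_sum; last by move=> s; exact: cintegrable_indic.
under eq_bigr do rewrite complex_expectation_indic// haar_support.
by rewrite sumr_const cardsE mulr_natl rmorphMn.
Qed.

End HaarMarginals.

(** * Expected value of the product along a path *)

Section PathValues.
Context (R : realType) (r : nat) (w : seq (letter r)) (U : set R[i]) (N : nat).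
Hypothesis U1 : U 1.
Hypothesis normU : forall u, U u -> `|u| = 1.

Definition conj_if (b : bool) (z : R[i]) : R[i] := if b then z^*%C else z.

Lemma conj_ifM b y z : conj_if b (y * z) = conj_if b y * conj_if b z.
Proof. by case: b => //=; rewrite rmorphM. Qed.

(** The character u^(p - q) of the circle is trivial on U: m divides p - q if U
is the set of m-th roots of unity, and p = q if U is the circle. *)
Definition entries_cancel (p q : nat) : bool :=
  `[< forall u, U u -> u ^+ p * (u^*%C) ^+ q = 1 >].

Definition path_value (f : vertex w -> 'I_N) (h : 'I_r -> 'M[R[i]]_N) : R[i] :=
  \prod_(k < size w) conj_if (letter_at k).2
    (h (letter_at k).1 (f (row_vertex k)) (f (col_vertex k))).

Lemma trace_word_eval (h : 'I_r -> 'M[R[i]]_N) :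
    (forall g, monomial_over U (h g)) ->
  \tr (\big[mulmx/1%:M]_(a <- w) letter_eval h a) =
  \sum_(f : {ffun vertex w -> 'I_N} | f ord0 == f ord_max) path_value f h.
Proof.
move=> hU; rewrite /mxtrace.
under eq_bigr do rewrite mulmx_prod_entry.
rewrite (exchange_big_dep (fun f : {ffun vertex w -> 'I_N} =>
    f ord0 == f ord_max)) /=; last by move=> x f _ /andP[/eqP -> /eqP ->].
apply: eq_bigr => f /eqP f0.
rewrite (big_pred1 (f ord0)); last first.
  by move=> x; rewrite -f0 andbb eq_sym.
apply: eq_bigr => k _; rewrite /letter_eval /conj_if /row_vertex /col_vertex.
rewrite -/(letter_at k); case: (letter_at k).2 => //.
exact: (invmx_monomial_over _ _ normU).
Qed.

Lemma prod_conj_if_row (f : vertex w -> 'I_N) (u : R[i]) (k : 'I_(size w)) :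
  \prod_(l | ((letter_at l).1 == (letter_at k).1) &&
             (f (row_vertex l) == f (row_vertex k))) conj_if (letter_at l).2 u
  = u ^+ row_count f false k * (u^*%C) ^+ row_count f true k.
Proof.
have side b : \prod_(l | ((letter_at l).1 == (letter_at k).1) &&
      (f (row_vertex l) == f (row_vertex k)) && ((letter_at l).2 == b))
      conj_if (letter_at l).2 u = conj_if b u ^+ row_count f b k.
  rewrite (eq_bigr (fun=> conj_if b u)); last first.
    by move=> l /andP[_ /eqP ->].
  rewrite prodr_const; congr (_ ^+ _); apply: eq_card => l; rewrite !inE.
  rewrite unfold_in andbAC; case: (letter_at l) => g c /=.
  by rewrite xpair_eqE.
rewrite (bigID (fun l => (letter_at l).2 == false)) /= side; congr (_ * _).
rewrite -(side true); apply: eq_bigl => l; congr (_ && _).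
by case: (letter_at l).2.
Qed.

Lemma cmeasurable_path_value (f : vertex w -> 'I_N) :
  cmeasurable (path_value f : joint_space (borel_mx R N) 'I_r -> R[i]).
Proof.
apply: cmeasurable_prod => k; rewrite /conj_if.
have mk : cmeasurable (fun h : joint_space (borel_mx R N) 'I_r =>
    (h (letter_at k).1 : 'M[R[i]]_N) (f (row_vertex k)) (f (col_vertex k))).
  exact: (cmeasurable_comp (measurable_coord _) (cmeasurable_entry _ _ _)).
by case: (letter_at k).2 => //; exact: cmeasurable_conj.
Qed.

Lemma path_value_le1 f (h : 'I_r -> 'M[R[i]]_N) :
  (forall g, monomial_over U (h g)) -> `|path_value f h| <= 1.
Proof.
move=> hU; rewrite normr_prod; apply: prodr_ile1 => k _.
rewrite normr_ge0 /=.
rewrite (_ : `|conj_if _ _| =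
  `|h (letter_at k).1 (f (row_vertex k)) (f (col_vertex k))|); last first.
  by rewrite /conj_if; case: (letter_at k).2 => //; rewrite normcJ.
have [->|nz] := eqVneq (h (letter_at k).1 (f (row_vertex k)) (f (col_vertex k))) 0.
  by rewrite normr0.
by rewrite normU//; apply: (hU _).2.
Qed.

(** If no factor vanishes, each is the only non-zero entry of its row.  Grouping
the factors by generator and row, each group multiplies to 1. *)
Lemma path_value_balanced f (h : 'I_r -> 'M[R[i]]_N) :
    balanced entries_cancel f -> (forall g, monomial_over U (h g)) ->
  path_value f h =
  ([forall k : 'I_(size w),
     h (letter_at k).1 (f (row_vertex k)) (f (col_vertex k)) != 0])%:R.
Proof.
move=> /forallP bal hU; case: (forallP (P := fun k : 'I_(size w) =>
  h (letter_at k).1 (f (row_vertex k)) (f (col_vertex k)) != 0)) => [nz|]; last first.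
  move=> /existsNP[k /negP]; rewrite negbK => /eqP hk.
  rewrite /path_value (bigD1 k)//= hk /conj_if.
  by case: ifP => _; rewrite ?conjc0 mul0r.
have supp g : exists s : {perm 'I_N}, forall i j, (h g i j != 0) = (s i == j).
  by apply: monomial_support; have [] := hU g.
have [s sE] := boolp.choice supp.
rewrite /path_value.
pose key (k : 'I_(size w)) := ((letter_at k).1, f (row_vertex k)).
rewrite (partition_big key predT)//= big1// => -[g x] _.
(* A row from which no factor is taken contributes the empty product. *)
have [[k /eqP keyk]|nk] := pselect (exists k, key k == (g, x)); last first.
  by rewrite big_pred0// => k; apply/negbTE/negP => kk; apply: nk; exists k.
have [gk xk] : g = (letter_at k).1 /\ x = f (row_vertex k).
  by case: keyk => -> ->.
rewrite (eq_bigr (fun l => conj_if (letter_at l).2 (h g x (s g x)))); last first.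
  move=> l /eqP[<- <-]; congr (conj_if _ (h _ _ _)).
  by apply/esym/eqP; rewrite -sE; exact: nz.
rewrite (eq_bigl (fun l => ((letter_at l).1 == (letter_at k).1) &&
             (f (row_vertex l) == f (row_vertex k)))); last first.
  by move=> l; rewrite /key xpair_eqE gk xk.
rewrite prod_conj_if_row; have /asboolP := bal k; apply.
by apply: (hU g).2; rewrite sE.
Qed.

Lemma path_value_scale_row f (h : 'I_r -> 'M[R[i]]_N) k u :
  path_value f (fun g => if g == (letter_at k).1
                         then scale_row (f (row_vertex k)) u (h g) else h g) =
  (u ^+ row_count f false k * (u^*%C) ^+ row_count f true k) * path_value f h.
Proof.
rewrite -prod_conj_if_row big_mkcond -big_split; apply: eq_bigr => l _ /=.
case: eqP => gl /=; last by rewrite mul1r.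
rewrite scale_rowE conj_ifM; case: eqP => // _.
by rewrite /conj_if; case: ifP; rewrite ?conjc1 !mul1r.
Qed.

Context (d : measure_display) (T : measurableType d) (P : probability T R)
  (X : 'I_r -> {RV P >-> borel_mx R N}).
Hypothesis indX : independent X.
Hypothesis haarX : forall g, haar_random (monomial_over U (N := N)) (X g).

Let XU t g : monomial_over U (X g t : 'M[R[i]]_N).
Proof. exact: (haarX g).1. Qed.

Lemma cintegrable_path_value f :
  cintegrable P (fun t => path_value f (fun g => X g t)).
Proof.
apply: cmeasurable_integrable => [|t]; last exact: path_value_le1.
apply: (cmeasurable_comp _ (cmeasurable_path_value f)).
by apply: measurable_joint => g; exact: measurable_funP.
Qed.

(** Some row has a factor c <> 1 by which the product is multiplied when that row
is scaled; as scaling does not change the joint law, the expected value e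
satisfies e = c e. *)
Lemma expectation_unbalanced f : ~~ balanced entries_cancel f ->
  complex_expectation P (fun t => path_value f (fun g => X g t)) = 0.
Proof.
rewrite negb_forall => /existsP[k /asboolPn].
move=> /existsNP[u /not_implyP[Uu cu]].
set c := u ^+ _ * _ in cu.
pose rescale (g : 'I_r) (M : borel_mx R N) : borel_mx R N :=
  if g == (letter_at k).1 then scale_row (f (row_vertex k)) u M else M.
have mrescale g : measurable_fun setT (rescale g).
  rewrite /rescale; case: (g == _); last exact: measurable_id.
  exact: measurable_scale_row.
have law := joint_law_transform indX mrescale.
have {}law : forall E : set (joint_space (borel_mx R N) 'I_r), measurable E ->
    P ((fun t i => rescale i (X i t)) @^-1` E) = P ((fun t i => X i t) @^-1` E).
  apply: law => g B mB; rewrite /rescale; case: (g == _) => //.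
  exact: (haar_scale_row U1 normU (haarX g) _ Uu mB).
suff : complex_expectation P (fun t => path_value f (fun g => rescale g (X g t))) =
       complex_expectation P (fun t => path_value f (fun g => X g t)).
  under [in LHS]eq_fun do rewrite path_value_scale_row.
  rewrite complex_expectationZ; last exact: cintegrable_path_value.
  move=> /eqP; rewrite -subr_eq0 -[X in _ - X]mul1r -mulrBl mulf_eq0 subr_eq0.
  by move=> /orP[/eqP //|/eqP].
have mX : measurable_fun setT
    ((fun t g => X g t) : T -> joint_space (borel_mx R N) 'I_r).
  by apply: measurable_joint => g; exact: measurable_funP.
have mY : measurable_fun setT
    ((fun t g => rescale g (X g t)) : T -> joint_space (borel_mx R N) 'I_r).
  by apply: measurable_joint => g; apply: measurableT_comp => //;
    exact: measurable_funP.
apply: (complex_expectation_same_law mY mX (cmeasurable_path_value f)) => //.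
  apply: cmeasurable_integrable => [|t].
    exact: (cmeasurable_comp mY (cmeasurable_path_value f)).
  rewrite /= path_value_scale_row normrM -/c (_ : `|c| = 1).
    by rewrite mul1r; exact: path_value_le1.
  by rewrite normrM !normrX normcJ normU// !expr1n mul1r.
exact: cintegrable_path_value.
Qed.

(** The product is the indicator of an intersection of one event for each
generator.  The probabilities of these events multiply, and each is a
proportion of permutations. *)
Lemma expectation_balanced f : balanced entries_cancel f ->
  complex_expectation P (fun t => path_value f (fun g => X g t)) =
  ratr (if matching f then (\prod_(g < r) (N ^_ edge_count f g)%:R)^-1 else 0).
Proof.
move=> bal.
pose B g : set (borel_mx R N) := [set M : 'M[R[i]]_N |
  forall k, k \in letters_of w g -> M (f (row_vertex k)) (f (col_vertex k)) != 0].
have mB g : measurable (B g) by exact: measurable_all_neq0.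
have mXB g : measurable (X g @^-1` B g).
  by rewrite -[X in measurable X]setTI; exact: measurable_funP.
rewrite (_ : (fun t => _) = fun t => (t \in \bigcap_g (X g @^-1` B g))%:R); last first.
  apply/funext => t; rewrite path_value_balanced//; congr (_%:R); congr nat_of_bool.
  apply/forallP/idP => [h|].
    by rewrite inE => g _ k; rewrite inE => /eqP <-; exact: h.
  by rewrite inE => h k; apply: (h (letter_at k).1) => //; rewrite inE.
rewrite complex_expectation_indic; last exact: fin_bigcap_measurable.
rewrite indX// (eq_bigr (fun g => (fine (P (X g @^-1` B g)))%:E)); last first.
  by move=> g _; rewrite fineK// fin_num_measure.
rewrite prodEFin /= rmorph_prod /=.
have factor g : fine (P (X g @^-1` B g)) =
    if [forall k in letters_of w g, forall l in letters_of w g,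
     (f (row_vertex k) == f (row_vertex l)) ==
     (f (col_vertex k) == f (col_vertex l))]
    then (N ^_ edge_count f g)%:R^-1 else 0.
  rewrite (haar_all_neq0 U1 (haarX g)) card_perm_extending card_ord.
  case: ifP => _; last by rewrite mul0r.
  have eN : (edge_count f g <= N)%N.
    by rewrite /edge_count -[leqRHS](card_ord N) max_card.
  by rewrite -[in N`!](ffact_fact eN) natrM invfM mulrCA divff ?mulr1//.
under eq_bigr do rewrite factor.
case: ifPn => [/forallP mat|].
  rewrite fmorphV rmorph_prod -prodfV; apply: eq_bigr => g _.
  by rewrite mat /= fmorphV !rmorph_nat.
rewrite negb_forall => /existsP[g /negbTE ng].
by rewrite (bigD1 g)//= ng mul0r rmorph0.
Qed.

Lemma expectation_trace_word :
  complex_expectation P (fun t =>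
    \tr (\big[mulmx/1%:M]_(a <- w) letter_eval (fun g => X g t : 'M[R[i]]_N) a)) =
  ratr (\sum_(f : {ffun vertex w -> 'I_N}) pattern_weight entries_cancel f N).
Proof.
under eq_fun do rewrite trace_word_eval//.
rewrite complex_expectation_sum; last by move=> f; exact: cintegrable_path_value.
rewrite rmorph_sum /= big_mkcond; apply: eq_bigr => f _.
rewrite /pattern_weight /contributes; case: eqP => _ /=; last by rewrite rmorph0.
have [bal|nbal] := boolP (balanced _ _).
  by rewrite expectation_balanced.
by rewrite expectation_unbalanced// rmorph0.
Qed.

End PathValues.

(** * Wreath products as groups of monomial matrices *)

Lemma wreath_monomial_over (R : realType) (G : forall N : nat, set 'M[R[i]]_N) :
  (exists m : nat, (2 <= m)%N /\ forall N, G N = @cyclic_wr_sym R m N)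
          \/ (forall N, G N = @circle_wr_sym R N) ->
  exists U : set R[i], [/\ U 1, forall u, U u -> `|u| = 1
    & forall N, G N = monomial_over U (N := N)].
Proof.
move=> [[m [_ GE]]|GE].
  exists [set u | `|u| = 1 /\ m.-unity_root u]; split=> [|u []//|N].
    by split; rewrite ?normr1//; apply/unity_rootP; rewrite expr1n.
  rewrite GE; apply/seteqP; split => M /=.
    by move=> [[monM M1] Mm]; split => // i j Mij; split; [exact: M1|exact: Mm].
  move=> [monM MU]; split=> [|i j /MU[]//]; split=> // i j /MU[].
  by [].
exists [set u | `|u| = 1]; split=> [|//|//].
by rewrite /= normr1.
Qed.

Theorem lemma1p9 (R : realType) (r : nat) (w : free_group r)
    (G : forall N : nat, set 'M[R[i]]_N)
    (hG : (exists m : nat, (2 <= m)%N /\ forall N, G N = @cyclic_wr_sym R m N)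
          \/ (forall N, G N = @circle_wr_sym R N)) :
  exists (f : {fraction {poly rat}}) (N0 : nat),
    forall N : nat, (N0 <= N)%N ->
    exists v : rat, ratfun_value f N%:R v /\
      forall (d : measure_display) (T : measurableType d)
        (P : probability T R) (A : 'I_r -> {RV P >-> borel_mx R N}),
        independent A -> (forall i, haar_random (G N) (A i)) ->
        complex_expectation P (fun t =>
          \tr (word_eval w (fun i => A i t : 'M[R[i]]_N)))
        = ratr v.
Proof.
have [U [U1 normU GU]] := wreath_monomial_over hG.
exists (trace_ratfun (sval w) (entries_cancel U)), (size (sval w)) => N wN.
exists (\sum_(f : {ffun vertex (sval w) -> 'I_N})
          pattern_weight (entries_cancel U) f N).
split; first exact: trace_ratfunP.
move=> d T P A indA haarA; apply: expectation_trace_word => // g.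
by rewrite -GU.
Qed.
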